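(* Let $V$ be an $n$-dimensional vector space over a field $L$, let $G$ be an abelian group acting linearly on $V$, and let $g_1,\dots,g_{n-1}\in G$. Let $\mathbb D\in C_n(V)$ be a fundamental domain fan for $(g_1,\dots,g_{n-1})$. Then the dual fan $\varphi(\mathbb D)\in C_n(V^* )$ is a fundamental domain fan for $(g_1,\dots,g_{n-1})$ (with respect to the action of $G$ on $V^*$).
   Context: For a vector space $U$ over $L$ (here $U=V$ or $U=V^*$, the dual space), $C_m(U)$ is the free $\mathbb Z$-module generated by symbols $\Lambda(a_1,\dots,a_m)$ with $a_1,\dots,a_m\in U\setminus\{0\}$, and $\partial_m:C_m(U)\to C_{m-1}(U)$ is $\partial_m\Lambda(a_1,\dots,a_m)=\sum_{i=1}^m(-1)^{i+1}\Lambda(a_1,\dots,\widehat{a_i},\dots,a_m)$ ($C_0=\mathbb Z$). For $n=\dim U$, $W(U)\subset C_n(U)$ is the submodule generated by the $\Lambda(a_1,\dots,a_n)$ with $a_1,\dots,a_n$ linearly dependent. $G$ acts on $V^*$ by $\langle x,gy\rangle=\langle gx,y\rangle$ for $x\in V$, $y\in V^*$. $G$ acts on $C_m(U)$ by $g\Lambda(a_1,\dots,a_m)=\Lambda(ga_1,\dots,ga_m)$, and $I_m(U\setminus\{0\},G)\subset C_m(U)$ is the submodule generated by all $gx-x$, $g\in G$, $x\in C_m(U)$. For $a\in U\setminus\{0\}$, $F(a;g_1,\dots,g_{n-1})=\sum_{\sigma\in\mathfrak S_{n-1}}\mathrm{sgn}(\sigma)\Lambda(a,g_{\sigma(1)}a,g_{\sigma(1)}g_{\sigma(2)}a,\dots,g_{\sigma(1)}\cdots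 g_{\sigma(n-1)}a)\in C_n(U)$. $\mathbb D\in C_n(U)$ is a fundamental domain fan for $(g_1,\dots,g_{n-1})$ if $\mathbb D-F(a;g_1,\dots,g_{n-1})\in I_n(U\setminus\{0\},G)+W(U)+\ker\partial_n$ for some $a\in U\setminus\{0\}$; this does not depend on the choice of $a$. The duality map $\varphi:C_n(V)\to C_n(V^* )$ is the homomorphism with $\varphi(\Lambda(a_1,\dots,a_n))=\Lambda(b_1,\dots,b_n)$, $(b_j)$ the dual basis of $(a_j)$, if $a_1,\dots,a_n$ are linearly independent, and $\varphi(\Lambda(a_1,\dots,a_n))=0$ otherwise. *)

(* Defs.v *)
From HB Require Import structures.
From mathcomp Require Import freeg.
From mathcomp Require Import all_boot all_fingroup all_algebra.

Set Implicit Arguments.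
Unset Strict Implicit.
Unset Printing Implicit Defensive.

Import GRing.Theory.
Local Open Scope ring_scope.

(* The values of [y : dual_space V] are taken by application: [y x] is <x, y>. *)
Notation dual_space V := 'Hom(V, _^o).

Definition nzvec (L : fieldType) (U : vectType L) := {u : U | u != 0}.

Definition vecs (L : fieldType) (U : vectType L) (m : nat)
    (a : m.-tuple (nzvec U)) : m.-tuple U :=
  [tuple of [seq val u | u <- a]].

Definition chain (m : nat) (L : fieldType) (U : vectType L) :=
  {freeg (m.-tuple (nzvec U)) / int}.

Definition Lambda (m : nat) (L : fieldType) (U : vectType L)
    (a : m.-tuple (nzvec U)) : chain m U :=
  [freeg [:: (1, a)]].

Definition face (m : nat) (T : Type) (a : m.-tuple T) (i : 'I_m) :
    m.-1.-tuple T :=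
  [tuple tnth a (fintype.lift i j) | j < m.-1].

(* Indices start at 0, so the sign of the i-th face is (-1) ^ i.  For m = 0 the
   sum is empty. *)
Definition boundary (m : nat) (L : fieldType) (U : vectType L)
    (x : chain m U) : chain m.-1 U :=
  fglift (fun a : m.-tuple (nzvec U) =>
    \sum_(i < m) (-1) ^+ i *: Lambda (face a i)) x.

Inductive zspan (M : zmodType) (S : M -> Prop) : M -> Prop :=
| zspan_gen x : S x -> zspan S x
| zspan0 : zspan S 0
| zspanB x y : zspan S x -> zspan S y -> zspan S (x - y).

(* The submodule W(U); only meant for n = dim U. *)
Definition degenerate (n : nat) (L : fieldType) (U : vectType L) :
    chain n U -> Prop :=
  zspan (fun x => exists2 a, ~~ free (vecs a) & x = Lambda a).

Record linear_action (G : groupType) (L : fieldType) (U : vectType L) :=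
  LinearAction {
    act :> G -> 'End(U);
    act1 : act 1%g = \1%VF;
    actM : forall g h : G, act (g * h)%g = (act g \o act h)%VF
  }.

Lemma act_neq0 (G : groupType) (L : fieldType) (U : vectType L)
    (rho : linear_action G U) (g : G) (a : nzvec U) : rho g (val a) != 0.
Proof.
apply/eqP => ga0; case/eqP: (valP a).
by rewrite -[LHS](id_lfunE (val a)) -(act1 rho) -(mulVg g) actM lfunE /= ga0
  linear0.
Qed.

Definition act_nz (G : groupType) (L : fieldType) (U : vectType L)
    (rho : linear_action G U) (g : G) (a : nzvec U) : nzvec U :=
  Sub (rho g (val a)) (act_neq0 rho g a).

Definition act_chain (G : groupType) (L : fieldType) (U : vectType L)
    (rho : linear_action G U) (m : nat) (g : G) (x : chain m U) : chain m U :=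
  fglift (fun a : m.-tuple (nzvec U) => Lambda [tuple of [seq act_nz rho g u | u <- a]]) x.

(* The submodule I_m(U \ {0}, G). *)
Definition coinv_ker (G : groupType) (L : fieldType) (U : vectType L)
    (rho : linear_action G U) (m : nat) : chain m U -> Prop :=
  zspan (fun z => exists (g : G) (x : chain m U), z = act_chain rho g x - x).

(* The j-th entry (counting from 0) is g_{s(1)} ... g_{s(j)} a. *)
Definition fan_entries (G : groupType) (L : fieldType) (U : vectType L)
    (rho : linear_action G U) (n : nat) (g : 'I_n.-1 -> G) (a : nzvec U)
    (s : 'S_n.-1) : n.-tuple (nzvec U) :=
  [tuple act_nz rho (\prod_(k < n.-1 | (k < j)%N) g (s k))%g a | j < n].

Definition fan (G : groupType) (L : fieldType) (U : vectType L)
    (rho : linear_action G U) (n : nat) (g : 'I_n.-1 -> G) (a : nzvec U) :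
    chain n U :=
  \sum_(s : 'S_n.-1) (-1) ^+ s *: Lambda (fan_entries rho g a s).

Definition fundamental_domain_fan (G : groupType) (L : fieldType)
    (U : vectType L) (rho : linear_action G U) (n : nat) (g : 'I_n.-1 -> G)
    (D : chain n U) : Prop :=
  exists (a : nzvec U) (x y z : chain n U),
    [/\ coinv_ker rho x, degenerate y, boundary z = 0
      & D - fan rho g a = x + y + z].

Section DualAction.
Variables (G : groupType) (L : fieldType) (V : vectType L).
Variables (Gab : forall h k : G, commute h k) (rho : linear_action G V).

Definition precomp (g : G) (y : dual_space V) : dual_space V := (y \o rho g)%VF.

Fact precomp_is_linear g : linear (precomp g).
Proof. by move=> k y z; rewrite /precomp comp_lfunDl comp_lfunZl. Qed.

HB.instance Definition _ g :=
  GRing.isSemilinear.Build L (dual_space V) (dual_space V) _ (precomp g)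
    (GRing.semilinear_linear (precomp_is_linear g)).

Definition dual_act (g : G) : 'End(dual_space V) := linfun (precomp g).

Lemma dual_actE g y x : dual_act g y x = y (rho g x).
Proof. by rewrite lfunE /= comp_lfunE. Qed.

Fact dual_act1 : dual_act 1%g = \1%VF.
Proof.
by apply/lfunP=> y; apply/lfunP=> x; rewrite dual_actE act1 !id_lfunE.
Qed.

Fact dual_actM g h : dual_act (g * h)%g = (dual_act g \o dual_act h)%VF.
Proof.
apply/lfunP=> y; apply/lfunP=> x.
by rewrite comp_lfunE !dual_actE Gab actM comp_lfunE.
Qed.

Definition dual_action : linear_action G (dual_space V) :=
  LinearAction dual_act1 dual_actM.

End DualAction.

Lemma dual_basis_neq0 (L : fieldType) (V : vectType L) (n : nat)
    (a : n.-tuple V) (fa : free a) (j : 'I_n) :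
  linfun (coord a j : V -> L^o) != 0 :> dual_space V.
Proof.
apply/eqP => /lfunP/(_ a`_j); rewrite lfunE /= coord_free // eqxx zero_lfunE.
by apply/eqP/oner_neq0.
Qed.

(* The dual basis of [a] is [coord a 0, ..., coord a (n - 1)] when the free
   family [a] is a basis, i.e. for n = dim V. *)
Definition dual_basis (L : fieldType) (V : vectType L) (n : nat)
    (a : n.-tuple V) (fa : free a) : n.-tuple (nzvec (dual_space V)) :=
  [tuple Sub (linfun (coord a j : V -> L^o)) (dual_basis_neq0 fa j) | j < n].

Lemma dual_basisE (L : fieldType) (V : vectType L) (n : nat) (a : n.-tuple V)
    (fa : free a) (i j : 'I_n) :
  val (tnth (dual_basis fa) j) (tnth a i) = (i == j)%:R.
Proof. by rewrite tnth_mktuple lfunE /= (tnth_nth 0) coord_free. Qed.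

Definition duality (L : fieldType) (V : vectType L) (n : nat)
    (x : chain n V) : chain n (dual_space V) :=
  fglift (fun a : n.-tuple (nzvec V) =>
    if @idP (free (vecs a)) is ReflectT fa then Lambda (dual_basis fa) else 0) x.

(* Main.v *)
From HB Require Import structures.
Require Import Defs.
From mathcomp Require Import freeg.
From mathcomp Require Import all_boot all_fingroup all_algebra zify.

(** Write St(U) for C_n(U) / (W(U) + ker d_n).  The proof takes place in one
    complex X in which the fans of V and those of V^* can be compared.

    A letter is either a point (a nonzero vector of V) or a form (a nonzero
    vector of V^* ), and X_m is spanned by the words of m letters in which every
    form vanishes at every point.  Putting a form that kills all the points of a
    word in front of that word is a contraction up to terms with fewer points
    ([ncone_homotopy]), and it is available unless the points span V.  Hence X is
    exact below degree n, and in degree n the only obstruction comes from the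
    words made of a basis of V ([fillP]).

    For a basis (a_i) with dual basis (b_i), the product of the differences
    a_i - b_i is a cycle of X_n ([bd_cross]): the boundary of a cross-polytope.
    Its words of points reduce to the word of the a_i, its words of forms to
    (-1)^n times the word of the b_i.  Subtracting such products from a cycle z
    of X_n removes the obstruction and leaves a boundary, and the words of forms
    of a boundary vanish in St(V^* ) ([form_chain_bd]).  So the form part of z is
    (-1)^n times the dual of its point part, in St(V^* ) ([form_chain_cycle]); in
    particular duality sends ker d_n to W + ker d_n ([duality_cycle]).

    It remains to compare fans.  Let g act on forms as given, and on points by
    its inverse, so that G acts on X and duality becomes equivariant.  The fans
    F(p; g_1, ..., g_k), for all sublists of the g_i, solve a Koszul equation
    ([bd_cube_cons]): the boundary of the value at a list is the alternating sum
    of (g_j - 1) times the values at the list without g_j.  As X is exact in low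
    degrees, the solutions that start from a form b and from a point a differ in
    degree n by a cycle and by elements of the form g x - x
    ([koszul_homotopy]).  Applying the previous paragraph to that cycle gives
    F(b; g) = duality (F(a; g)) in the coinvariants of St(V^* ) ([duality_cube]).
    The points move by the inverses of the g_i in X; translating by the product
    of the g_i turns this into the given action, at the cost of the sign
    (-1)^(n-1), which combines with (-1)^n and the sign of the difference to 1
    ([bd_twisted_cube]). *)

Set Implicit Arguments.
Unset Strict Implicit.
Unset Printing Implicit Defensive.

Import GRing.Theory.
Local Open Scope ring_scope.

(** * Integral spans and free abelian groups *)

Section ZSpan.
Variables (M : zmodType) (S : M -> Prop).

Lemma zspanN x : zspan S x -> zspan S (- x).
Proof. by rewrite -sub0r; apply: zspanB; apply: zspan0. Qed.

Lemma zspanD x y : zspan S x -> zspan S y -> zspan S (x + y).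
Proof. by move=> Sx Sy; rewrite -[y]opprK; apply/zspanB/zspanN. Qed.

Lemma zspanMz x (k : int) : zspan S x -> zspan S (x *~ k).
Proof.
move=> Sx; have SMn m : zspan S (x *+ m).
  by elim: m => [|m IH]; rewrite ?mulrS; [apply: zspan0 | apply: zspanD].
by case: k => m; [apply: SMn | apply/zspanN/SMn].
Qed.

Lemma zspan_sum (I : Type) (r : seq I) (F : I -> M) :
  (forall i, zspan S (F i)) -> zspan S (\sum_(i <- r) F i).
Proof. by move=> SF; elim/big_ind: _ => //; [apply: zspan0 | apply: zspanD]. Qed.

End ZSpan.

Lemma zspan_map (M N : zmodType) (f : {additive M -> N}) (S : M -> Prop)
    (S' : N -> Prop) x :
  (forall y, S y -> zspan S' (f y)) -> zspan S x -> zspan S' (f x).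
Proof.
move=> fS; elim=> [||y z _ fy _ fz]; first exact: fS.
  by rewrite raddf0; apply: zspan0.
by rewrite raddfB; apply: zspanB.
Qed.

Lemma zspanZ (M : lmodType int) (S : M -> Prop) x (k : int) :
  zspan S x -> zspan S (k *: x).
Proof. by rewrite -[k]intz scaler_int; apply: zspanMz. Qed.

HB.instance Definition _ (K : choiceType) (M : lmodType int) (f : K -> M) :=
  GRing.isZmodMorphism.Build {freeg K / int} M (fglift f) (lift_is_additive f).

Definition gen (K : choiceType) (w : K) : {freeg K / int} := [freeg [:: (1, w)]].

Lemma fglift_gen (K : choiceType) (M : lmodType int) (f : K -> M) w :
  fglift f (gen w) = f w.
Proof. by rewrite liftU scale1r. Qed.

Definition carried (K : choiceType) (P : K -> Prop) : {freeg K / int} -> Prop :=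
  zspan (fun x => exists2 w, P w & x = gen w).

Section Carried.
Variable K : choiceType.
Implicit Types (P : K -> Prop) (x : {freeg K / int}).

Lemma carried_gen P w : P w -> carried P (gen w).
Proof. by move=> Pw; apply: zspan_gen; exists w. Qed.

Lemma carried_map (N : zmodType) (f : {additive {freeg K / int} -> N}) P
    (S : N -> Prop) x :
  (forall w, P w -> zspan S (f (gen w))) -> carried P x -> zspan S (f x).
Proof. by move=> fS; apply: zspan_map => _ [w Pw ->]; apply: fS. Qed.

Lemma carriedW P P' x : (forall w, P w -> P' w) -> carried P x -> carried P' x.
Proof.
by move=> PP'; apply: (carried_map (f := idfun)) => w /PP'; apply: carried_gen.
Qed.

Lemma carriedT x : carried (fun _ => True) x.
Proof.
rewrite -[x]freeg_sumE; apply: zspan_sum => w.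
have -> : << coeff w x *g w >> = coeff w x *: gen w :> {freeg K / int}.
  by apply/eqP/freeg_eqP => v; rewrite coeffZ !coeffU mul1r.
exact/zspanZ/carried_gen.
Qed.

Lemma eq_additive (N : zmodType) (f g : {additive {freeg K / int} -> N}) :
  (forall w, f (gen w) = g (gen w)) -> f =1 g.
Proof.
move=> fg x; elim: (carriedT x) => [_ [w _ ->]||y z _ Ey _ Ez] //.
  by rewrite !raddf0.
by rewrite !raddfB Ey Ez.
Qed.

End Carried.

(** * Alternating sums and words *)

Section Alternating.
Variables (T : Type).

(** The alternating sum of [u x l] over the letters [x] of [s], where [l] is [s]
    without [x].  Both the simplicial boundary and the Koszul differential have
    this shape; the recursion on the list spares the index arithmetic. *)
Fixpoint alt (M : zmodType) (u : T -> seq T -> M) (s : seq T) : M :=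
  if s is x :: s' then u x s' - alt (fun y l => u y (x :: l)) s' else 0.

Definition deletion (x : T) (l s : seq T) :=
  exists s1 s2, s = s1 ++ x :: s2 /\ l = s1 ++ s2.

Lemma deletion_cons x y l s : deletion x l s -> deletion x (y :: l) (y :: s).
Proof. by case=> s1 [s2 [-> ->]]; exists (y :: s1), s2. Qed.

Lemma size_deletion x l s : deletion x l s -> size s = (size l).+1.
Proof. by case=> s1 [s2 [-> ->]]; rewrite !size_cat addnS. Qed.

Section Zmod.
Variable M : zmodType.
Implicit Types u v : T -> seq T -> M.

(** Induction principle for alternating sums: a property stable under differences
    has to be checked on each deletion only. *)
Lemma alt_closed (P : M -> Prop) u s :
    P 0 -> (forall x y, P x -> P y -> P (x - y)) ->
  (forall x l, deletion x l s -> P (u x l)) -> P (alt u s).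
Proof.
move=> P0 PB; elim: s u => [|x s IH] u Pu //=; apply: PB.
  by apply: Pu; exists [::], s.
by apply: IH => y l ys; apply/Pu/deletion_cons.
Qed.

Lemma altB u v s : alt (fun x l => u x l - v x l) s = alt u s - alt v s.
Proof.
elim: s u v => [|x s IH] u v /=; first by rewrite subrr.
by rewrite IH !opprD !opprK addrACA.
Qed.

Lemma eq_alt u v s :
  (forall x l, deletion x l s -> u x l = v x l) -> alt u s = alt v s.
Proof.
move=> uv; apply/eqP; rewrite -subr_eq0 -altB; apply/eqP.
apply: (alt_closed (P := fun z => z = 0)) => // [x y -> ->|x l xs].
  exact: subrr.
by rewrite uv ?subrr.
Qed.

Lemma raddf_alt (N : zmodType) (f : {additive M -> N}) u s :
  f (alt u s) = alt (fun x l => f (u x l)) s.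
Proof.
elim: s u => [|x s IH] u /=; first exact: raddf0.
by rewrite raddfB IH.
Qed.

(** Two letters can be deleted in either order, and the two orders come with
    opposite signs. *)
Lemma alt_alt0 (v : T -> T -> seq T -> M) s :
    (forall x y l, v x y l = v y x l) ->
  alt (fun x l => alt (fun y l' => v x y l') l) s = 0.
Proof.
elim: s v => [|x s IH] v vC //=; rewrite altB (IH (fun y z l => v y z (x :: l))).
  by rewrite subr0; apply/eqP; rewrite subr_eq0; apply/eqP/eq_alt => y l _.
by move=> y z l; apply: vC.
Qed.

End Zmod.

Lemma altE (M : lmodType int) (u : T -> seq T -> M) x0 s :
  alt u s =
    \sum_(i < size s) (-1) ^+ i *: u (nth x0 s i) (take i s ++ drop i.+1 s).
Proof.
elim: s u => [|x s IH] u /=; first by rewrite big_ord0.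
rewrite big_ord_recl /= expr0 scale1r drop0 IH -sumrN; congr (_ + _).
by apply: eq_bigr => i _; rewrite exprS mulN1r scaleNr.
Qed.

End Alternating.

Section Words.
Variable T : choiceType.
Implicit Types (x : T) (w : seq T) (c : {freeg (seq T) / int}).

Definition bd : {freeg (seq T) / int} -> {freeg (seq T) / int} :=
  fglift (alt (fun _ l => gen l)).

Definition cone x : {freeg (seq T) / int} -> {freeg (seq T) / int} :=
  fglift (fun w => gen (x :: w)).

HB.instance Definition _ := GRing.Additive.on bd.
HB.instance Definition _ x := GRing.Additive.on (cone x).

Lemma bd_gen w : bd (gen w) = alt (fun _ l => gen l) w.
Proof. exact: fglift_gen. Qed.

Lemma cone_gen x w : cone x (gen w) = gen (x :: w).
Proof. exact: fglift_gen. Qed.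

(** Only the first letter distinguishes the faces of a cone, so every computation
    of a boundary below is an induction on words through this formula. *)
Lemma bd_cone x c : bd (cone x c) = c - cone x (bd c).
Proof.
pose f := bd \o cone x; pose g := idfun \- (cone x \o bd).
apply: (eq_additive (f := f) (g := g)) => w.
rewrite /f /g /= cone_gen !bd_gen raddf_alt /=; congr (_ - _).
by apply: eq_alt => y l _; rewrite cone_gen.
Qed.

Lemma bd_bd c : bd (bd c) = 0.
Proof.
have bdbd w : bd (bd (gen w)) = 0.
  elim: w => [|x w IH]; first by rewrite bd_gen /= raddf0.
  by rewrite -cone_gen bd_cone raddfB /= bd_cone IH raddf0 subr0 subrr.
by apply: (eq_additive (f := bd \o bd) (g := \0)) => w; apply: bdbd.
Qed.

End Words.

Arguments bd {T}.

(** * Maps of words, and tuples as words *)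

Section WordMaps.
Variables T T' : choiceType.
Implicit Types (w : seq T) (c : {freeg (seq T) / int}).

Definition wmap (f : T -> T') : {freeg (seq T) / int} -> {freeg (seq T') / int} :=
  fglift (fun w => gen (map f w)).

HB.instance Definition _ f := GRing.Additive.on (wmap f).

Lemma wmap_gen f w : wmap f (gen w) = gen (map f w).
Proof. exact: fglift_gen. Qed.

Lemma wmap_cone f x c : wmap f (cone x c) = cone (f x) (wmap f c).
Proof.
apply: (eq_additive (f := wmap f \o cone x) (g := cone (f x) \o wmap f)) => w.
by rewrite /= cone_gen !wmap_gen cone_gen.
Qed.

Lemma bd_wmap f c : bd (wmap f c) = wmap f (bd c).
Proof.
have bd_wmap_gen w : bd (wmap f (gen w)) = wmap f (bd (gen w)).
  elim: w => [|x w IH]; first by rewrite wmap_gen !bd_gen /= raddf0.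
  by rewrite -cone_gen wmap_cone !bd_cone raddfB /= wmap_cone IH.
by apply: (eq_additive (f := bd \o wmap f) (g := wmap f \o bd)).
Qed.

Variable p : T -> option T'.

Fixpoint pure w : {freeg (seq T') / int} :=
  if w is x :: w' then if p x is Some y then cone y (pure w') else 0
  else gen [::].

Definition proj : {freeg (seq T) / int} -> {freeg (seq T') / int} := fglift pure.

HB.instance Definition _ := GRing.Additive.on proj.

Lemma proj_gen w : proj (gen w) = pure w.
Proof. exact: fglift_gen. Qed.

Lemma proj_coneS x y c : p x = Some y -> proj (cone x c) = cone y (proj c).
Proof.
move=> pxy; apply: (eq_additive (f := proj \o cone x) (g := cone y \o proj)) => w.
by rewrite /= cone_gen !proj_gen /= pxy.
Qed.

Lemma proj_coneN x c : p x = None -> proj (cone x c) = 0.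
Proof.
move=> pxN; apply: (eq_additive (f := proj \o cone x) (g := \0)) => w.
by rewrite /= cone_gen proj_gen /= pxN.
Qed.

Lemma pureE w : pure w = if all (isSome \o p) w then gen (pmap p w) else 0.
Proof.
elim: w => //= x w ->; case: (p x) => //= y.
by case: ifP; rewrite ?raddf0 ?cone_gen.
Qed.

(** The projection onto the words written in one of two alphabets commutes with
    the boundary except on the words with a single letter in the other one: only
    the face omitting that letter survives. *)
Lemma proj_bd w :
  carried (fun l => [/\ size w = (size l).+1, {subset map Some l <= map p w}
                      & exists2 x, x \in w & p x = None])
    (proj (bd (gen w)) - bd (proj (gen w))).
Proof.
elim: w => [|x w IH].
  by rewrite bd_gen proj_gen /= bd_gen raddf0 subrr; apply: zspan0.
rewrite -cone_gen bd_cone raddfB /=; case px: (p x) => [y|].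
  rewrite !(proj_coneS _ px) bd_cone opprB addrC subrKA.
  rewrite -(raddfB (cone y)) /= -[X in cone y X]opprB (raddfN (cone y)) /=.
  apply: zspanN.
  apply: carried_map IH => l [wl lw [z zw pz]]; rewrite /= cone_gen.
  apply: carried_gen; split; first by rewrite /= wl.
    move=> v; rewrite /= !inE => /predU1P[-> | /lw ->]; last by rewrite orbT.
    by rewrite eqxx.
  by exists z => //; rewrite inE zw orbT.
rewrite !(proj_coneN _ px) (raddf0 bd) !subr0 proj_gen pureE.
case: ifP => [wS|_]; last exact: zspan0.
have szw : size (pmap p w) = size w.
  by rewrite size_pmap; apply/eqP; rewrite -all_count.
apply: carried_gen; split; first by rewrite /= szw.
  move=> v; rewrite pmapS_filter => /mapP[z]; rewrite mem_filter => /andP[_ zw] ->.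
  by rewrite /= inE map_f ?orbT.
by exists x; rewrite ?mem_head.
Qed.

End WordMaps.

Lemma wmap_comp (T1 T2 T3 : choiceType) (g : T2 -> T3) (f : T1 -> T2)
    (h : T1 -> T3) c :
  (forall x, g (f x) = h x) -> wmap g (wmap f c) = wmap h c.
Proof.
move=> gf; apply: (eq_additive (f := wmap g \o wmap f) (g := wmap h)) => w.
by rewrite /= !wmap_gen -map_comp; congr gen; apply: eq_map.
Qed.

Lemma proj_wmap (T1 T2 T1' T2' : choiceType) (p : T1 -> option T1')
    (q : T2 -> option T2') (f : T1 -> T2) (f' : T1' -> T2') c :
  (forall x, q (f x) = omap f' (p x)) -> proj q (wmap f c) = wmap f' (proj p c).
Proof.
move=> qf; pose F := proj q \o wmap f; pose F' := wmap f' \o proj p.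
apply: (eq_additive (f := F) (g := F')) => w; rewrite /F /F' /= wmap_gen !proj_gen.
elim: w => [|x w IH] /=; first by rewrite wmap_gen.
rewrite qf; case: (p x) => [y|] /=; last by rewrite raddf0.
by rewrite IH wmap_cone.
Qed.

Section Tuples.
Variables (L : fieldType) (U : vectType L) (m : nat).

HB.instance Definition _ := GRing.isZmodMorphism.Build (chain m U)
  (chain m.-1 U) (@boundary m L U) (lift_is_additive _).

(** Chains of [m]-tuples are handled as combinations of words of any length; the
    words of another length are sent to zero. *)
Definition to_chain : {freeg (seq (nzvec U)) / int} -> chain m U :=
  fglift (fun w => if insub w is Some t then Lambda t else 0 : chain m U).

Definition of_chain : chain m U -> {freeg (seq (nzvec U)) / int} :=
  fglift (fun t : m.-tuple (nzvec U) => gen (val t)).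

HB.instance Definition _ := GRing.isZmodMorphism.Build
  {freeg (seq (nzvec U)) / int} (chain m U) to_chain (lift_is_additive _).
HB.instance Definition _ := GRing.isZmodMorphism.Build
  (chain m U) {freeg (seq (nzvec U)) / int} of_chain (lift_is_additive _).

Lemma of_chain_Lambda (t : m.-tuple (nzvec U)) : of_chain (Lambda t) = gen (val t).
Proof. exact: fglift_gen. Qed.

Lemma to_chain_tuple (t : m.-tuple (nzvec U)) : to_chain (gen (val t)) = Lambda t.
Proof. by rewrite /to_chain fglift_gen valK. Qed.

Lemma to_chain_size w : size w != m -> to_chain (gen w) = 0.
Proof. by move=> wm; rewrite /to_chain fglift_gen insubN. Qed.

Lemma of_chainK x : to_chain (of_chain x) = x.
Proof.
apply: (eq_additive (f := to_chain \o of_chain) (g := idfun)) => t /=.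
by rewrite of_chain_Lambda to_chain_tuple.
Qed.

Lemma of_chain_size x : carried (fun w => size w = m) (of_chain x).
Proof.
apply: (carried_map (f := of_chain) (P := fun _ => True)) (carriedT x) => t _.
by rewrite /= of_chain_Lambda; apply: carried_gen; rewrite size_tuple.
Qed.

End Tuples.

Arguments to_chain {L U} m.
Arguments of_chain {L U m}.

Lemma val_face (T : Type) m (t : m.-tuple T) (i : 'I_m) :
  val (face t i) = take i t ++ drop i.+1 t.
Proof.
have im := ltn_ord i; have x0 := tnth t i.
apply: (@eq_from_nth _ x0) => [|j].
  by rewrite size_tuple size_cat size_take size_drop size_tuple im; lia.
rewrite size_tuple => jm; rewrite -[j]/(val (Ordinal jm)) -tnth_nth tnth_mktuple.
rewrite (tnth_nth x0) nth_cat size_take size_tuple im /= /bump leqNgt.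
by case: ltnP => ij; rewrite ?nth_take ?nth_drop //=; congr nth; lia.
Qed.

Section Boundary.
Variables (L : fieldType) (U : vectType L).

Lemma boundary_Lambda m (t : m.-tuple (nzvec U)) :
  boundary (Lambda t) = \sum_(i < m) (-1) ^+ i *: Lambda (face t i).
Proof. exact: fglift_gen. Qed.

Lemma bd_of_chain m (x : chain m U) : bd (of_chain x) = of_chain (boundary x).
Proof.
pose f := bd \o @of_chain L U m; pose g := @of_chain L U m.-1 \o @boundary m L U.
apply: (eq_additive (f := f) (g := g)) => t; rewrite /f /g {f g} /=.
rewrite of_chain_Lambda boundary_Lambda bd_gen raddf_sum /=.
have -> : alt (fun _ l => gen l) t =
    \sum_(i < m) (-1) ^+ i *: gen (take i t ++ drop i.+1 t).
  case: m {x} t => [|m] t; first by rewrite tuple0 big_ord0.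
  rewrite (altE _ (thead t)) -(big_mkord xpredT (fun i =>
    (-1) ^+ i *: gen (take i t ++ drop i.+1 t))).
  by rewrite size_tuple big_mkord.
by apply: eq_bigr => i _; rewrite raddfZsign /= of_chain_Lambda val_face.
Qed.

(** For [m = 0] this fails on the words of length one: [to_chain 0] discards them,
    but keeps their face. *)
Lemma boundary_to_chain m c :
  (0 < m)%N -> boundary (to_chain m c : chain m U) = to_chain m.-1 (bd c).
Proof.
move=> m_gt0; pose f := @boundary m L U \o @to_chain L U m.
apply: (eq_additive (f := f) (g := @to_chain L U m.-1 \o bd)) => w.
rewrite {}/f /=; have [wm|wm] := boolP (size w == m).
  pose t : m.-tuple (nzvec U) := Tuple wm.
  by rewrite -[w]/(val t) to_chain_tuple -of_chain_Lambda bd_of_chain of_chainK.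
rewrite to_chain_size // raddf0 bd_gen raddf_alt /=; apply/esym.
apply: (alt_closed (P := fun z => z = 0)) => // [x y -> ->|x l xw].
  exact: subrr.
rewrite to_chain_size //; apply: contraNneq wm => lm.
by rewrite (size_deletion xw) lm prednK.
Qed.

Variables (G : groupType) (rho : linear_action G U).

HB.instance Definition _ m g := GRing.isZmodMorphism.Build (chain m U)
  (chain m U) (@act_chain G L U rho m g) (lift_is_additive _).

Lemma to_chain_act m g c :
  to_chain m (wmap (act_nz rho g) c) = act_chain rho g (to_chain m c).
Proof.
pose f := @to_chain L U m \o wmap (act_nz rho g).
pose f' := @act_chain G L U rho m g \o @to_chain L U m.
apply: (eq_additive (f := f) (g := f')) => w; rewrite {}/f {}/f' /= wmap_gen.
have [wm|wm] := boolP (size w == m); last first.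
  by rewrite !to_chain_size ?size_map // raddf0.
pose t : m.-tuple (nzvec U) := Tuple wm; rewrite -[w]/(val t) to_chain_tuple.
by rewrite /act_chain fglift_gen -to_chain_tuple.
Qed.

End Boundary.

(** * Mixed words of points and forms *)

Section Incidence.
Variables (L : fieldType) (V : vectType L).
Local Notation point := (nzvec V).
Local Notation form := (nzvec (dual_space V)).
Local Notation letter := (point + form)%type.
Implicit Types (A : seq point) (w : seq letter).

Definition kills (b : form) (a : point) : bool := val b (val a) == 0.

Definition incident (x y : letter) : bool :=
  match x, y with
  | inl a, inr b | inr b, inl a => kills b a
  | _, _ => true
  end.

Definition lpart (x : letter) : option point := if x is inl a then Some a else None.
Definition rpart (x : letter) : option form := if x is inr b then Some b else None.

Definition points w : seq point := pmap lpart w.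

Definition spanning A : bool := (fullv <= <<map val A>>)%VS.

(** The words spanning X_m: every form vanishes at every point. *)
Definition compatible m w : Prop := size w = m /\ pairwise incident w.

Lemma incidentC : symmetric incident.
Proof. by case=> [a|b] [a'|b']. Qed.

Lemma all_incident_inr b w : all (incident (inr b)) w = all (kills b) (points w).
Proof. by elim: w => [|[a|b'] w IH] //=; rewrite IH. Qed.

Lemma exists_form_neq0 (v : V) : v != 0 -> exists y : dual_space V, y v != 0.
Proof.
move=> v0; have [i vi] : exists i, coord (vbasis fullv) i v != 0.
  apply/existsP; apply: contraNT v0 => /existsPn v_i.
  rewrite (coord_vbasis (memvf v)) big1 // => i _.
  by have:= v_i i; rewrite negbK => /eqP ->; rewrite scale0r.
by exists (linfun (coord (vbasis fullv) i : V -> L^o)); rewrite lfunE.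
Qed.

(** A linear form on the quotient of V by the span of [A].  The quotient is
    realised by the complement of the projection onto the span. *)
Lemma exists_killing A : ~~ spanning A -> exists b : form, all (kills b) A.
Proof.
case/subvPn => v _ vA; set U := <<_>>%VS in vA; pose q := (\1 - projv U)%VF.
have qE u : q u = u - projv U u by rewrite !lfun_simp.
have [y yv] : exists y : dual_space V, y (q v) != 0.
  apply: exists_form_neq0; rewrite qE subr_eq0; apply: contraNneq vA => ->.
  exact: memv_proj.
have yq0 : (y \o q)%VF != 0 :> dual_space V.
  by apply: contraNneq yv => /lfunP/(_ v); rewrite comp_lfunE zero_lfunE => ->.
exists (Sub (y \o q)%VF yq0); apply/allP => a aA; rewrite /kills SubK comp_lfunE qE.
by rewrite projv_id ?subrr ?linear0 //; apply/memv_span/map_f.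
Qed.

Lemma killed_nonspanning b A : all (kills b) A -> ~~ spanning A.
Proof.
move/allP => bA; apply: contraNN (valP b) => /= full.
have /subvP bker : (fullv <= lker (val b))%VS.
  apply: subv_trans full _; apply/span_subvP => _ /mapP[a /bA bv ->].
  by rewrite memv_ker.
apply/eqP/lfunP => v; rewrite zero_lfunE; apply/eqP.
by rewrite -memv_ker; apply/bker/memvf.
Qed.

Lemma nonspanning_size A : (size A < \dim {:V})%N -> ~~ spanning A.
Proof.
move=> szA; apply: contraL szA => /dimvS full; rewrite -leqNgt.
by apply: leq_trans full _; rewrite (leq_trans (dim_span _)) ?size_map.
Qed.

Lemma nonspanning_nonfree A :
  size A = \dim {:V} -> ~~ free (map val A) -> ~~ spanning A.
Proof.
move=> szA; apply: contraNN => /dimvS full.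
by rewrite /free eqn_leq dim_span size_map szA.
Qed.

Lemma spanningS A A' : {subset A' <= A} -> ~~ spanning A -> ~~ spanning A'.
Proof.
move=> sA; apply: contraNN => full; apply: subv_trans full _.
by apply: sub_span => _ /mapP[a /sA aA ->]; apply: map_f.
Qed.

Lemma pairwise_incident_inr b w :
  pairwise incident w -> inr b \in w -> all (kills b) (points w).
Proof.
rewrite -all_incident_inr; elim: w => //= x w IH /andP[xw ww].
rewrite inE => /predU1P[bx | bw]; first by rewrite bx xw -bx.
have := allP xw _ bw; rewrite incidentC => bx.
by apply/andP; split; [exact: bx | exact: IH].
Qed.

Section Filling.
Variable b0 : form.

(** A form killing [A]; the default [b0] is reached only when [A] spans V. *)
Definition normal A : form :=
  if @idP (~~ spanning A) is ReflectT nA then xchoose (exists_killing nA) else b0.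

Lemma normalP A : ~~ spanning A -> all (kills (normal A)) A.
Proof.
rewrite /normal; case: {-}_ / idP => // nA _.
exact: (xchooseP (exists_killing nA)).
Qed.

Definition ncone : {freeg (seq letter) / int} -> {freeg (seq letter) / int} :=
  fglift (fun w => gen (inr (normal (points w)) :: w)).

HB.instance Definition _ := GRing.Additive.on ncone.

Lemma ncone_gen w : ncone (gen w) = gen (inr (normal (points w)) :: w).
Proof. exact: fglift_gen. Qed.

Definition fillable m k w : Prop :=
  [/\ compatible m w, ~~ spanning (points w) & (size (points w) < k)%N].

Lemma ncone_compatible m k x :
  carried (fillable m k) x -> carried (compatible m.+1) (ncone x).
Proof.
apply: carried_map => w [[wm ww] wP _]; rewrite /= ncone_gen; apply: carried_gen.
by split; rewrite /= ?wm // all_incident_inr normalP.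
Qed.

(** The form put in front depends on the points of the word only.  Hence in the
    homotopy formula the faces that omit a form cancel, and those that omit a
    point remain, with one point less. *)
Lemma ncone_homotopy m k w : fillable m k.+1 w ->
  carried (fillable m k) (gen w - bd (ncone (gen w)) - ncone (bd (gen w))).
Proof.
case=> [[wm ww] wP wk]; rewrite ncone_gen -cone_gen bd_cone subKr.
rewrite bd_gen (raddf_alt (cone _)) (raddf_alt ncone) /= -altB.
apply: alt_closed => [||x l]; [exact: zspan0 | exact: zspanB |].
case=> s1 [s2 [Ew El]]; rewrite cone_gen ncone_gen.
have [x_pt|/negbNE/eqP x_form] := boolP (lpart x != None); last first.
  have -> : points w = points l by rewrite Ew El /points !pmap_cat /= x_form.
  by rewrite subrr; apply: zspan0.
have lw : subseq l w.
  by rewrite Ew El cat_subseq ?subseq_cons.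
have lP : {subset points l <= points w}.
  by move=> a; rewrite !mem_pmap => /(mem_subseq (map_subseq _ lw)).
have lPk : (size (points l) < k)%N.
  move: wk x_pt; rewrite Ew El /points !pmap_cat !size_cat /=.
  by case: (lpart x) => //= a; rewrite addnS ltnS.
have fl d : all (kills d) (points l) -> carried (fillable m k) (gen (inr d :: l)).
  move=> dl; apply: carried_gen; split=> //; last exact: spanningS wP.
  split=> /=; first by rewrite -wm Ew El !size_cat /= addnS.
  by rewrite all_incident_inr dl (subseq_pairwise lw).
apply: zspanB; apply: fl; last exact/normalP/(spanningS lP).
by apply/allP => a /lP; apply/allP/normalP.
Qed.

(** The geometric series of the contraction [ncone]; the defect of the homotopy
    formula loses a point at each step, so [k] steps suffice for words with less
    than [k] points. *)
Fixpoint fill k (x : {freeg (seq letter) / int}) : {freeg (seq letter) / int} :=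
  if k is k'.+1 then ncone x + fill k' (x - bd (ncone x)) else 0.

Lemma fillP m k x : carried (fillable m k) x -> bd x = 0 ->
  bd (fill k x) = x /\ carried (compatible m.+1) (fill k x).
Proof.
elim: k x => [|k IH] x xF xZ.
  have -> : x = 0.
    by elim: xF {xZ} => [y [w [_ _]]||y z _ -> _ ->]; rewrite ?ltn0 ?subrr.
  by rewrite /= raddf0; split=> //; apply: zspan0.
have [|/=|yE yX] := IH (x - bd (ncone x)).
- pose f := idfun \- (bd \o ncone) \- (ncone \o bd).
  have -> : x - bd (ncone x) = f x by rewrite /f /= xZ (raddf0 ncone) subr0.
  by apply: (carried_map (f := f)) xF => w; apply: ncone_homotopy.
- by rewrite raddfB /= bd_bd subr0.
split; first by rewrite /= raddfD /= yE addrC subrK.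
by apply: zspanD yX; apply: ncone_compatible xF.
Qed.

End Filling.

(** The product of the differences [a - b] over the pairs of [l]: the fundamental
    cycle of the boundary of a cross-polytope with antipodal vertices [a], [b]. *)
Fixpoint cross (l : seq (point * form)) : {freeg (seq letter) / int} :=
  if l is (a, b) :: l' then cone (inl a) (cross l') - cone (inr b) (cross l')
  else gen [::].

Lemma bd_cross l : bd (cross l) = 0.
Proof.
elim: l => [|[a b] l IH] /=; first by rewrite bd_gen.
by rewrite raddfB /= !bd_cone IH !raddf0 subrr.
Qed.

Lemma rproj_cross l : proj rpart (cross l) = (-1) ^+ size l *: gen (unzip2 l).
Proof.
elim: l => [|[a b] l IH] /=; first by rewrite proj_gen scale1r.
rewrite raddfB /= proj_coneN // (proj_coneS (y := b)) // sub0r IH.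
by rewrite raddfZsign /= cone_gen exprS mulN1r scaleNr.
Qed.

(** The term of the product that takes [a] in every factor is the only one without
    a form. *)
Lemma cross_top l :
    pairwise (fun p q => kills p.2 q.1 && kills q.2 p.1) l ->
  carried (fun w => compatible (size l) w /\ exists b, inr b \in w)
    (cross l - gen (map inl (unzip1 l))).
Proof.
pose meets (y : letter) (p : point * form) :=
  incident y (inl p.1) && incident y (inr p.2).
pose R l w :=
  compatible (size l) w /\ forall y, all (meets y) l -> all (incident y) w.
have Rtop k : R k (map inl (unzip1 k)).
  split; first split; first by rewrite !size_map.
    by elim: k => //= p k ->; rewrite andbT; apply/allP => _ /mapP[c _ ->].
  move=> y /allP yk; apply/allP => _ /mapP[_ /mapP[p /yk /andP[yp _] ->] ->].
  exact: yp.
move=> lP; apply: (@carriedW _ (fun w => R l w /\ exists b, inr b \in w)).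
  by move=> w [[]].
elim: l lP => [|[a b] l IH] /=; first by rewrite subrr => _; apply: zspan0.
move=> /andP[/allP abl /IH{}IH].
have meets_a : all (meets (inl a)) l by apply/allP => q /abl /andP[].
have meets_b : all (meets (inr b)) l.
  by apply/allP => q /abl /andP[bq _]; rewrite /meets /= bq.
have Rcons x w : all (meets x) l -> (forall y, meets y (a, b) -> incident y x) ->
    R l w -> R ((a, b) :: l) (x :: w).
  move=> xl xab [[wl ww] lw]; split; first by split; rewrite /= ?wl // lw.
  by move=> y /andP[/xab yx /lw yw]; rewrite /= yx.
rewrite -cone_gen addrAC -raddfB /=; apply: zspanB.
  apply: carried_map IH => w [wR [c cw]]; rewrite /= cone_gen; apply: carried_gen.
  by split; [apply: Rcons => // y /andP[] | exists c; rewrite inE cw orbT].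
rewrite -[cross l](subrK (gen (map inl (unzip1 l)))).
suff bR : carried (R l) (cross l - gen (map inl (unzip1 l)) +
    gen (map inl (unzip1 l))).
  apply: carried_map bR => w wR; rewrite /= cone_gen; apply: carried_gen.
  by split; [apply: Rcons => // y /andP[] | exists b; rewrite mem_head].
apply: zspanD; last exact/carried_gen/Rtop.
by apply: carriedW IH => w [].
Qed.

End Incidence.

(** * The duality map on homology classes *)

Section DualityClass.
Variables (L : fieldType) (V : vectType L) (n : nat).
Hypotheses (dimV : \dim {:V} = n) (n_gt0 : (0 < n)%N).
Local Notation point := (nzvec V).
Local Notation form := (nzvec (dual_space V)).
Local Notation letter := (point + form)%type.

(** The chains that vanish in St(U). *)
Definition null_class m (U : vectType L) : chain m U -> Prop :=
  zspan (fun y => degenerate y \/ boundary y = 0).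

HB.instance Definition _ := GRing.isZmodMorphism.Build (chain n V)
  (chain n (dual_space V)) (@duality L V n) (lift_is_additive _).

Lemma duality_free (a : n.-tuple point) (fa : free (vecs a)) :
  duality (Lambda a) = Lambda (dual_basis fa).
Proof.
rewrite /duality fglift_gen; case: {-}_ / idP => // fa'.
by rewrite (bool_irrelevance fa' fa).
Qed.

Lemma duality_dependent (a : n.-tuple point) :
  ~~ free (vecs a) -> duality (Lambda a) = 0.
Proof. by move=> /negP fa; rewrite /duality fglift_gen; case: {-}_ / idP. Qed.

(** Otherwise the [n] forms would be a basis of the dual, and every form would
    vanish at [a]. *)
Lemma killed_dependent (B : n.-tuple form) a :
  (forall b, b \in B -> kills b a) -> ~~ free (vecs B).
Proof.
move=> Ba; apply/negP => freeB; have [y /negP[]] := exists_form_neq0 (valP a).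
have dimV' : \dim {:dual_space V} = n.
  by rewrite dimvf /dim /= -dimV dimvf muln1.
have /eqP spanB : (<<vecs B>> == fullv)%VS.
  by rewrite eqEdim subvf dimV' (eqP freeB) size_map size_tuple leqnn.
have yB : y \in <<vecs B>>%VS by rewrite spanB memvf.
rewrite (coord_span yB) sum_lfunE big1 // => i _.
rewrite scale_lfunE (nth_map (tnth B i)) ?size_tuple //.
by rewrite (eqP (Ba _ _)) ?scaler0 // mem_nth ?size_tuple.
Qed.

Definition point_chain (c : {freeg (seq letter) / int}) : chain n V :=
  to_chain n (proj (@lpart L V) c).
Definition form_chain (c : {freeg (seq letter) / int}) : chain n (dual_space V) :=
  to_chain n (proj (@rpart L V) c).

HB.instance Definition _ := GRing.isZmodMorphism.Build
  {freeg (seq letter) / int} (chain n V) point_chain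
  (raddfB (to_chain n \o proj (@lpart L V))).
HB.instance Definition _ := GRing.isZmodMorphism.Build
  {freeg (seq letter) / int} (chain n (dual_space V)) form_chain
  (raddfB (to_chain n \o proj (@rpart L V))).

(** If the word consists of forms, this is a boundary of a boundary.  If it has a
    single point, all its forms vanish at that point, so that the only face
    without points is degenerate.  Otherwise every face contains a point. *)
Lemma form_chain_bd x :
  carried (compatible n.+1) x -> null_class (form_chain (bd x)).
Proof.
apply: (carried_map (f := form_chain \o bd)) => w [wn ww] /=; rewrite /form_chain.
rewrite -[proj _ _](subrK (bd (proj (@rpart L V) (gen w)))) raddfD /=.
apply: zspanD; last first.
  by apply: zspan_gen; right; rewrite boundary_to_chain // bd_bd raddf0.
apply: carried_map (proj_bd _ w) => l [wl lw [[a|//] aw _]] /=.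
have ln : size l == n by rewrite -eqSS -wl wn.
pose t : n.-tuple form := Tuple ln; rewrite -[l]/(val t) to_chain_tuple.
apply: zspan_gen; left; apply: zspan_gen; exists t => //.
apply: (killed_dependent (a := a)) => b bt.
have /lw/mapP[[//|b'] bw [Eb]] : Some b \in map Some l by apply: map_f.
rewrite -{b'}Eb in bw.
have /allP := pairwise_incident_inr ww bw; apply.
by rewrite mem_pmap; apply/mapP; exists (inl a).
Qed.

(** Lifts the symbol of a basis to the cycle of X_n whose point part it is. *)
Definition spread : chain n V -> {freeg (seq letter) / int} :=
  fglift (fun a : n.-tuple point =>
    if @idP (free (vecs a)) is ReflectT fa then cross (zip a (dual_basis fa))
    else 0).

HB.instance Definition _ := GRing.isZmodMorphism.Build (chain n V)
  {freeg (seq letter) / int} spread (lift_is_additive _).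

Lemma spread_free (a : n.-tuple point) (fa : free (vecs a)) :
  spread (Lambda a) = cross (zip a (dual_basis fa)).
Proof.
rewrite /spread fglift_gen; case: {-}_ / idP => // fa'.
by rewrite (bool_irrelevance fa' fa).
Qed.

Lemma spread_dependent (a : n.-tuple point) :
  ~~ free (vecs a) -> spread (Lambda a) = 0.
Proof. by move=> /negP fa; rewrite /spread fglift_gen; case: {-}_ / idP. Qed.

Lemma bd_spread y : bd (spread y) = 0.
Proof.
apply: (eq_additive (f := bd \o spread) (g := \0)) => a /=.
have [fa|fa] := boolP (free (vecs a)); first by rewrite (spread_free fa) bd_cross.
by rewrite spread_dependent // raddf0.
Qed.

Lemma form_chain_spread y : form_chain (spread y) = (-1) ^+ n *: duality y.
Proof.
pose g : chain n V -> chain n (dual_space V) := *:%R ((-1) ^+ n) \o @duality L V n.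
apply: (eq_additive (f := form_chain \o spread) (g := g)) => a; rewrite /g /=.
have [fa|fa] := boolP (free (vecs a)); last first.
  by rewrite spread_dependent // duality_dependent // raddf0 scaler0.
rewrite (spread_free fa) (duality_free fa) /form_chain rproj_cross.
rewrite size_zip !size_tuple minnn unzip2_zip ?size_tuple //.
by rewrite raddfZsign -to_chain_tuple.
Qed.

Lemma dual_basis_cross (a : n.-tuple point) (fa : free (vecs a)) :
  pairwise (fun p q => kills p.2 q.1 && kills q.2 p.1) (zip a (dual_basis fa)).
Proof.
have [a0 b0] : point * form.
  split; first exact: (tnth a (Ordinal n_gt0)).
  exact: (tnth (dual_basis fa) (Ordinal n_gt0)).
apply/(pairwiseP (a0, b0)) => i j; rewrite !inE size_zip !size_tuple minnn.
move=> ilt jlt ij; rewrite !nth_zip ?size_tuple //=.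
have E k l (kn : (k < n)%N) (ln : (l < n)%N) : l != k ->
    kills (nth b0 (dual_basis fa) k) (nth a0 a l).
  move=> lk; rewrite /kills.
  rewrite -[k]/(val (Ordinal kn)) -[l]/(val (Ordinal ln)) -!tnth_nth.
  rewrite -[val (tnth a _)]/((fun u => val u) _) -[_ (tnth a _)]tnth_map.
  by rewrite -/(vecs a) dual_basisE -val_eqE /= (negbTE lk).
by rewrite !E // neq_ltn ij ?orbT.
Qed.

(** After subtraction of the lift of its point part, a word no longer contains a
    basis of V, so that the contraction applies to what is left. *)
Lemma spread_residue w : compatible n w ->
  carried (fillable n n.+1) (gen w - spread (point_chain (gen w))).
Proof.
move=> [wn ww].
have fl v : compatible n v -> ~~ spanning (points v) -> fillable n n.+1 v.
  by move=> [vn vv] vP; split; rewrite // ltnS -vn size_pmap count_size.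
have fr v b : compatible n v -> inr b \in v -> fillable n n.+1 v.
  move=> vC bv; apply: fl => //.
  exact: killed_nonspanning (pairwise_incident_inr vC.2 bv).
rewrite /point_chain proj_gen pureE -/(points w).
case: ifP => [w_pt|/negbT]; last first.
  case/allPn => [[//|b]] bw _; rewrite raddf0 (raddf0 spread) subr0.
  by apply: carried_gen; apply: fr bw.
have wE : w = map inl (points w).
  by elim: w w_pt {wn ww} => //= [[a|//] w IH] /= /IH {1}->.
have tn : size (points w) == n by rewrite -wn [in X in _ == X]wE size_map.
pose t : n.-tuple point := Tuple tn; rewrite -[points w]/(val t) to_chain_tuple.
have [ft|ft] := boolP (free (vecs t)); last first.
  rewrite spread_dependent // subr0; apply/carried_gen/fl => //.
  by apply: nonspanning_nonfree ft; rewrite size_tuple dimV.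
rewrite (spread_free ft) -opprB; apply: zspanN.
have := cross_top (dual_basis_cross ft).
rewrite unzip1_zip ?size_tuple // -wE.
by apply: carriedW => v [vC [b bv]]; apply: fr bv.
Qed.

(** A cycle differs from the lift of its point part by a boundary, and the form
    part of that lift is the dual of the point part, up to sign. *)
Lemma form_chain_cycle x : carried (compatible n) x -> bd x = 0 ->
  null_class (form_chain x - (-1) ^+ n *: duality (point_chain x)).
Proof.
move=> xC xZ; rewrite -form_chain_spread -raddfB /=.
have [|b0 _] := exists_killing (A := [::] : seq point).
  by apply: nonspanning_size; rewrite dimV.
pose f := idfun \- (spread \o point_chain).
have fF : carried (fillable n n.+1) (f x).
  by apply: (carried_map (f := f)) xC => w; apply: spread_residue.
have [|yE yC] := fillP b0 fF; first by rewrite /f raddfB /= xZ bd_spread subr0.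
by rewrite -[x - _]/(f x) -yE; apply: form_chain_bd.
Qed.

End DualityClass.

(** * Koszul cochains *)

Section Koszul.
Variables (T : choiceType) (G : Type) (act : G -> T -> T).
Hypothesis actC : forall g h x, act g (act h x) = act h (act g x).
Local Notation words := {freeg (seq T) / int}.
Implicit Types (h u : seq G -> words) (gs : seq G).

(** The differential of the cochains on the Koszul resolution of the trivial
    module; the value of a cochain at [gs] plays the role of its value on the
    exterior product of the elements of [gs]. *)
Definition koszul h gs : words := alt (fun g l => wmap (act g) (h l) - h l) gs.

Lemma wmap_actC g g' (c : words) :
  wmap (act g) (wmap (act g') c) = wmap (act g') (wmap (act g) c).
Proof.
pose f k k' := wmap (act k) \o wmap (act k').
apply: (eq_additive (f := f g g') (g := f g' g)) => w; rewrite /f /= !wmap_gen.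
by rewrite -!map_comp; congr gen; apply: eq_map => x /=; apply: actC.
Qed.

Lemma eq_koszul h h' gs :
  (forall l, size gs = (size l).+1 -> h l = h' l) -> koszul h gs = koszul h' gs.
Proof.
by move=> hh'; apply: eq_alt => g l gl; rewrite (hh' l (size_deletion gl)).
Qed.

Lemma koszulB u h gs : koszul (fun l => u l - h l) gs = koszul u gs - koszul h gs.
Proof.
rewrite -altB; apply: eq_alt => g l _.
by rewrite raddfB /= !opprD addrACA.
Qed.

Lemma koszulZsign k h gs :
  koszul (fun l => (-1) ^+ k *: h l) gs = (-1) ^+ k *: koszul h gs.
Proof.
rewrite /koszul (raddf_alt ( *:%R ((-1) ^+ k))); apply: eq_alt => g l _.
by rewrite /= scalerBr raddfZsign.
Qed.

(** The operators [g - 1] commute with each other. *)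
Lemma koszul_koszul h gs : koszul (koszul h) gs = 0.
Proof.
pose d g (c : words) := wmap (act g) c - c.
have dC g g' c : d g (d g' c) = d g' (d g c).
  rewrite /d !(raddfB (wmap _)) /= wmap_actC !opprB.
  by rewrite addrACA [X in _ + _ + X]addrC addrACA.
rewrite -[RHS](alt_alt0 (v := fun g g' l => d g (d g' (h l))) gs) //.
apply: eq_alt => g l _; rewrite raddf_alt -altB.
by apply: eq_alt => g' l' _.
Qed.

(** The recursion of the triangulated cube with edges [gs]: choose the first edge
    [g] out of [p], then continue in the face at [g p]. *)
Fixpoint cube_rec k p gs : words :=
  if k is k'.+1 then cone p (alt (fun g l => wmap (act g) (cube_rec k' p l)) gs)
  else gen [:: p].

Definition cube p gs : words := cube_rec (size gs) p gs.

Lemma cube_nil p : cube p [::] = gen [:: p]. Proof. by []. Qed.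

Lemma cube_cons p g gs :
  cube p (g :: gs) = cone p (alt (fun g l => wmap (act g) (cube p l)) (g :: gs)).
Proof.
rewrite {1}/cube [size _]/=; congr (cone p _); apply: eq_alt => g' l gl.
by have [->] := size_deletion gl.
Qed.

Lemma bd_cube_nil p : bd (cube p [::]) = gen [::].
Proof. by rewrite cube_nil bd_gen /= subr0. Qed.

(** The face opposite to [p] contributes the terms [g F(l)].  Removing [p] from the
    others leaves, by induction, a double alternating sum: its part in [g g'] is
    symmetric and cancels, and what remains is the sum of the [F(l)]. *)
Lemma bd_cube_cons p g gs : bd (cube p (g :: gs)) = koszul (cube p) (g :: gs).
Proof.
have [k] := ubnP (size gs); elim: k g gs => // k IH g gs; rewrite ltnS => gsk.
rewrite cube_cons bd_cone /koszul altB; congr (_ - _).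
case: gs gsk => [|g' gs] gsk.
  by rewrite /= !subr0 bd_wmap bd_cube_nil wmap_gen cone_gen.
set s := g :: g' :: gs.
pose v i j l := wmap (act i) (cube p l) + wmap (act j) (cube p l).
have -> : alt (fun _ l => cube p l) s =
    cone p (alt (fun _ l => alt (fun j l' => wmap (act j) (cube p l')) l) s).
  rewrite raddf_alt; apply: eq_alt => i l il; have := size_deletion il.
  by case: l {il} => [//|j l] _; rewrite /= cube_cons.
congr (cone p _); apply/eqP; rewrite -subr_eq0; apply/eqP.
rewrite raddf_alt -altB.
transitivity (alt (fun i l => alt (fun j l' =>
    wmap (act i) (wmap (act j) (cube p l'))) l) s -
    alt (fun i l => alt (fun j l' => v i j l') l) s).
  rewrite -altB; apply: eq_alt => i l il; have := size_deletion il.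
  case: l {il} => [//|j l] [szl].
  have bd_l : bd (wmap (act i) (cube p (j :: l))) =
      wmap (act i) (koszul (cube p) (j :: l)).
    by rewrite bd_wmap IH // -ltnS -szl.
  move: (j :: l) bd_l => l1 bd_l; rewrite /= bd_l.
  rewrite /koszul (raddf_alt (wmap _)) -!altB; apply: eq_alt => i' l' _.
  by rewrite (raddfB (wmap _)) /= /v opprD addrA.
rewrite -[RHS](subrr 0); congr (_ - _); last first.
  by apply: (alt_alt0 (v := v)) => i j l; apply: addrC.
apply: (alt_alt0 (v := fun i j l => wmap (act i) (wmap (act j) (cube p l)))).
by move=> i j l; apply: wmap_actC.
Qed.

Lemma cube_size p gs :
  carried (fun w => size w = (size gs).+1) (cube p gs).
Proof.
have [k] := ubnP (size gs); elim: k gs => // k IH [|g gs] gsk.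
  by rewrite cube_nil; apply: carried_gen.
rewrite cube_cons.
apply: (carried_map (f := cone p) (P := fun w => size w = (size gs).+1)).
  by move=> w wn; rewrite /= cone_gen; apply: carried_gen; rewrite /= wn.
apply: alt_closed => [||g' l gl]; [exact: zspan0 | exact: zspanB |].
have [szl] := size_deletion gl.
apply: carried_map (IH l _) => [w wn|]; last by rewrite -szl.
by rewrite /= wmap_gen; apply: carried_gen; rewrite size_map szl wn.
Qed.

(** Dimension shifting.  If a complex is exact below degree [n], with primitives
    picked by [K], a solution of [bd u = koszul u] is the coboundary of a cochain
    [h] up to a cycle; this is the uniqueness up to homotopy of a chain map out of
    the Koszul resolution, applied to the difference of two such maps. *)
Lemma koszul_homotopy (n : nat) (X : nat -> seq T -> Prop) (K : words -> words) u :
    (forall m g x, carried (X m) x -> carried (X m) (wmap (act g) x)) ->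
    (forall m x, (m < n)%N -> carried (X m) x -> bd x = 0 ->
       bd (K x) = x /\ carried (X m.+1) (K x)) ->
    (forall gs, carried (X (size gs).+1) (u gs)) ->
    (forall gs, bd (u gs) = koszul u gs) ->
  exists h, forall gs, (size gs < n)%N ->
    carried (X (size gs).+1) (u gs - koszul h gs) /\ bd (u gs - koszul h gs) = 0.
Proof.
move=> X_act XK uX bdu.
(* As [koszul h gs] involves [h] on the lists shorter than [gs] only, iterating
   the equation for [h] once more than [gs] has entries solves it. *)
pose step h gs := K (u gs - koszul h gs).
pose h gs := iter (size gs).+1 step (fun _ => 0) gs.
have hE gs : h gs = K (u gs - koszul h gs).
  by rewrite /h iterS /step; congr (K (_ - _)); apply: eq_koszul => l ->.
exists h => gs; have [k] := ubnP (size gs); elim: k gs => // k IH gs gsk gsn.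
have IHl g l : deletion g l gs ->
    bd (h l) = u l - koszul h l /\ carried (X (size gs).+1) (h l).
  move=> gl; have szl := size_deletion gl; rewrite hE szl.
  have [||zX zZ] := IH l; [by rewrite -szl | by rewrite -szl ltnW|].
  by apply: XK => //; rewrite -szl.
split.
  apply: zspanB; first exact: uX.
  rewrite /koszul.
  apply: (alt_closed (P := carried (X (size gs).+1))) => [||g l gl].
  - exact: zspan0.
  - exact: zspanB.
  - by have [_ hX] := IHl _ _ gl; apply: zspanB => //; apply: X_act.
rewrite raddfB /= bdu.
have -> : bd (koszul h gs) = koszul (fun l => u l - koszul h l) gs.
  rewrite /koszul raddf_alt; apply: eq_alt => g l gl.
  by have [<- _] := IHl _ _ gl; rewrite raddfB /= bd_wmap.
by rewrite koszulB koszul_koszul subr0 subrr.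
Qed.

End Koszul.

Lemma wmap_cube (T T' : choiceType) (G : Type) (act : G -> T -> T)
    (act' : G -> T' -> T') (f : T -> T') p gs :
  (forall g x, f (act g x) = act' g (f x)) ->
  wmap f (cube act p gs) = cube act' (f p) gs.
Proof.
move=> f_act; have [k] := ubnP (size gs); elim: k gs => // k IH [|g gs] gsk.
  by rewrite !cube_nil wmap_gen.
rewrite !cube_cons wmap_cone (raddf_alt (wmap f)); congr (cone _ _).
apply: eq_alt => g' l gl; have [szl] := size_deletion gl.
rewrite -IH; last by rewrite -szl.
by rewrite /= !(wmap_comp (h := f \o act g')) // => x /=; rewrite f_act.
Qed.

(** * The fan as a Koszul cochain *)

Section FanCube.
Variables (L : fieldType) (U : vectType L) (G : groupType).
Variable rho : linear_action G U.

Lemma act_nzM g h a : act_nz rho g (act_nz rho h a) = act_nz rho (g * h)%g a.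
Proof. by apply: val_inj; rewrite /= Defs.actM comp_lfunE. Qed.

Lemma act_nz1 a : act_nz rho 1%g a = a.
Proof. by apply: val_inj; rewrite /= Defs.act1 id_lfunE. Qed.

Lemma fan_entries_lift k (g : 'I_k.+1 -> G) a i (s : 'S_k) :
  val (fan_entries (n := k.+2) rho g a (lift_perm ord0 i s)) =
  a :: map (act_nz rho (g i))
    (val (fan_entries (n := k.+1) rho (g \o lift i) a s)).
Proof.
rewrite /= enum_ordSl /= big_pred0 // act_nz1; congr cons.
rewrite -!map_comp; apply: eq_map => j /=; rewrite act_nzM; congr act_nz.
rewrite big_mkcond big_ord_recl /= lift_perm_id; congr mulg.
rewrite [RHS]big_mkcond; apply: eq_bigr => l _ /=.
by rewrite lift_perm_lift /bump !add1n ltnS.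
Qed.

(** A permutation is given by its first value and a permutation of the remaining
    ones; injectivity suffices by counting. *)
Lemma sum_perm_lift k (M : zmodType) (F : 'S_k.+1 -> M) :
  \sum_s F s = \sum_(i < k.+1) \sum_s F (lift_perm ord0 i s).
Proof.
rewrite pair_big /= (reindex (fun p : 'I_k.+1 * 'S_k => lift_perm ord0 p.1 p.2)) //.
apply: onW_bij; apply: inj_card_bij => [[i s] [j t] /= E|].
  have ij : i = j by rewrite -(lift_perm_id ord0 i s) E lift_perm_id.
  congr pair => //; apply/permP => l; apply: (@lift_inj _ j).
  by rewrite -(lift_perm_lift ord0 j t) -E -ij lift_perm_lift.
by rewrite card_prod card_ord !card_Sn factS.
Qed.

Lemma cube_fan k (g : 'I_k -> G) a :
  cube (act_nz rho) a (map g (enum 'I_k)) =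
  \sum_(s : 'S_k) (-1) ^+ s *: gen (val (fan_entries (n := k.+1) rho g a s)).
Proof.
elim: k g => [|k IH] g.
  rewrite (big_pred1 1%g) => [|s]; last by rewrite [s]permS0 /= eqxx.
  rewrite odd_perm1 scale1r {1}enum_ord0 cube_nil /= enum_ordSl enum_ord0 /=.
  by rewrite big_pred0 ?act_nz1 // => -[].
rewrite {1}enum_ordSl [map _ _]/= cube_cons.
rewrite -[g ord0 :: _]/(map g (_ :: _)) -enum_ordSl.
rewrite (altE _ (g ord0)) sum_perm_lift raddf_sum size_map size_enum_ord.
apply: eq_bigr => i _.
rewrite (nth_map ord0) ?size_enum_ord // nth_ord_enum.
pose t := [tuple g j | j < k.+1].
have -> : take i (map g (enum 'I_k.+1)) ++ drop i.+1 (map g (enum 'I_k.+1)) =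
    map (g \o lift i) (enum 'I_k).
  rewrite -[map g _]/(val t) -val_face /=; apply: eq_map => j /=.
  by rewrite tnth_mktuple.
rewrite IH raddfZsign (raddf_sum (wmap _)) (raddf_sum (cone a)) scaler_sumr.
apply: eq_bigr => s _; rewrite fan_entries_lift -cone_gen.
rewrite odd_lift_perm [odd ord0]/= addFb signr_addb signr_odd -scalerA.
rewrite (raddfZsign (wmap _)) (raddfZsign (cone a)).
by congr (_ *: (_ *: cone a _)); apply: wmap_gen.
Qed.

Lemma to_chain_cube k (g : 'I_k -> G) a :
  to_chain k.+1 (cube (act_nz rho) a (map g (enum 'I_k))) =
  fan (n := k.+1) rho g a.
Proof.
rewrite cube_fan raddf_sum; apply: eq_bigr => s _.
by rewrite raddfZsign; congr (_ *: _); apply: to_chain_tuple.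
Qed.

End FanCube.

(** * The fan and its dual *)

Section Duality.
Variables (L : fieldType) (V : vectType L) (n : nat).
Hypotheses (dimV : \dim {:V} = n) (n_gt0 : (0 < n)%N).
Variables (G : groupType) (Gab : forall h k : G, commute h k).
Variable rho : linear_action G V.
Local Notation point := (nzvec V).
Local Notation form := (nzvec (dual_space V)).
Local Notation letter := (point + form)%type.
Local Notation rho' := (dual_action Gab rho).
Local Notation of_points := (wmap (@inl point form)).
Local Notation of_forms := (wmap (@inr point form)).

(** The contragredient action on points keeps the pairing invariant, so that [G]
    acts on the compatible words. *)
Definition pair_act (g : G) (x : letter) : letter :=
  match x with
  | inl a => inl (act_nz rho g^-1%g a)
  | inr b => inr (act_nz rho' g b)
  end.

Lemma pair_actM g h x : pair_act g (pair_act h x) = pair_act (g * h)%g x.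
Proof.
case: x => [a|b] /=; rewrite act_nzM //.
by rewrite -invgM Gab.
Qed.

Lemma pair_actC g h x : pair_act g (pair_act h x) = pair_act h (pair_act g x).
Proof. by rewrite !pair_actM Gab. Qed.

Lemma act_invK g v : rho g (rho g^-1%g v) = v.
Proof. by rewrite -comp_lfunE -Defs.actM mulgV Defs.act1 id_lfunE. Qed.

Lemma dual_act_inv g (y : dual_space V) v : rho' g y (rho g^-1%g v) = y v.
Proof. by rewrite [LHS]dual_actE act_invK. Qed.

Lemma incident_pair_act g x y :
  incident (pair_act g x) (pair_act g y) = incident x y.
Proof. by case: x y => [a|b] [a'|b'] //=; rewrite /kills /= dual_act_inv. Qed.

Lemma pair_act_carried m g x :
  carried (@compatible L V m) x ->
  carried (@compatible L V m) (wmap (pair_act g) x).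
Proof.
apply: carried_map => w [wm ww]; rewrite /= wmap_gen; apply: carried_gen.
split; first by rewrite size_map.
rewrite pairwise_map; apply: sub_pairwise ww => y z /=.
by rewrite incident_pair_act.
Qed.

Lemma point_chain_act g x :
  point_chain n (wmap (pair_act g) x) = act_chain rho g^-1%g (point_chain n x).
Proof.
rewrite /point_chain -to_chain_act.
by rewrite (proj_wmap (p := @lpart L V) (f' := act_nz rho g^-1%g)) //; case.
Qed.

Lemma form_chain_act g x :
  form_chain n (wmap (pair_act g) x) = act_chain rho' g (form_chain n x).
Proof.
rewrite /form_chain -to_chain_act.
by rewrite (proj_wmap (p := @rpart L V) (f' := act_nz rho' g)) //; case.
Qed.

(** On a basis of V there is no choice for the forms. *)
Lemma dual_basis_unique (a : n.-tuple point) (fa : free (vecs a))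
    (B : n.-tuple form) :
  (forall i j, val (tnth B j) (val (tnth a i)) = (i == j)%:R) -> B = dual_basis fa.
Proof.
move=> Ba; apply: eq_from_tnth => j; apply: val_inj; apply/lfunP => v.
have spana : <<vecs a>>%VS = fullv.
  by apply/eqP; rewrite eqEdim subvf dimV (eqP fa) size_map size_tuple leqnn.
have va : v \in <<vecs a>>%VS by rewrite spana memvf.
rewrite (coord_span va) !linear_sum; apply: eq_bigr => i _; rewrite !linearZ /=.
congr (_ *: _); rewrite -tnth_nth dual_basisE -Ba.
by rewrite tnth_map.
Qed.

Lemma act_tuple_free g (a : n.-tuple point) :
  free (vecs [tuple of map (act_nz rho g) a]) = free (vecs a).
Proof.
have E : vecs [tuple of map (act_nz rho g) a] = map (rho g) (vecs a) :> seq V.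
  by rewrite /= -!map_comp.
rewrite /free E -limg_span size_map limg_dim_eq //.
have /eqP -> : lker (rho g) == 0%VS; last exact: capv0.
apply/lker0P; apply: (can_inj (g := rho g^-1%g)) => v.
by have := act_invK g^-1%g v; rewrite invgK.
Qed.

(** By invariance of the pairing, the translates of the dual basis by [g] take the
    values 0 and 1 on the translates of the basis by the inverse of [g]. *)
Lemma duality_act g (y : chain n V) :
  duality (act_chain rho g^-1%g y) = act_chain rho' g (duality y).
Proof.
pose f := @duality L V n \o @act_chain G L V rho n g^-1%g.
pose f' := @act_chain G L _ rho' n g \o @duality L V n.
apply: (eq_additive (f := f) (g := f')) => a; rewrite /f /f' {f f'} /=.
rewrite [act_chain _ _ _]fglift_gen; have [fa|fa] := boolP (free (vecs a)).
  have fga : free (vecs [tuple of map (act_nz rho g^-1%g) a]).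
    by rewrite act_tuple_free.
  rewrite (duality_free fa) (duality_free fga) /act_chain fglift_gen.
  congr Lambda; apply/esym/dual_basis_unique => i j.
  by rewrite -(dual_basisE fa i j) !tnth_map; apply: dual_act_inv.
by rewrite -[gen a]/(Lambda a) !duality_dependent ?act_tuple_free // raddf0.
Qed.

Lemma proj_lpart_inl c : proj (@lpart L V) (of_points c) = c.
Proof.
pose f := proj (@lpart L V) \o of_points.
apply: (eq_additive (f := f) (g := idfun)) => w; rewrite /f /= wmap_gen proj_gen.
by elim: w => //= a w ->; rewrite cone_gen.
Qed.

Lemma proj_rpart_inr c : proj (@rpart L V) (of_forms c) = c.
Proof.
pose f := proj (@rpart L V) \o of_forms.
apply: (eq_additive (f := f) (g := idfun)) => w; rewrite /f /= wmap_gen proj_gen.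
by elim: w => //= a w ->; rewrite cone_gen.
Qed.

Lemma point_chain_of_forms c : point_chain n (of_forms c) = 0.
Proof.
apply: (eq_additive (f := @point_chain L V n \o of_forms) (g := \0)) => w /=.
rewrite /point_chain wmap_gen proj_gen; case: w => [|b w] /=; last exact: raddf0.
by rewrite to_chain_size // eq_sym -lt0n.
Qed.

Lemma form_chain_of_points c : form_chain n (of_points c) = 0.
Proof.
apply: (eq_additive (f := @form_chain L V n \o of_points) (g := \0)) => w /=.
rewrite /form_chain wmap_gen proj_gen; case: w => [|b w] /=; last exact: raddf0.
by rewrite to_chain_size // eq_sym -lt0n.
Qed.


Lemma prod_deletion g (l gs : seq G) :
  deletion g l gs -> (\prod_(h <- gs) h = g * \prod_(h <- l) h)%g.
Proof.
case=> s1 [s2 [-> ->]]; rewrite !big_cat big_cons /= !mulgA.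
by congr (_ * _)%g; apply: Gab.
Qed.

(** In X the points move by the inverses of the elements of [gs], whereas the fan
    of V uses the elements themselves.  Translating it by the inverse of the
    product of [gs] (which is how that product acts on points in X) gives a
    Koszul cochain again, up to sign. *)
Definition twisted_cube a (gs : seq G) : {freeg (seq letter) / int} :=
  wmap (pair_act (\prod_(h <- gs) h)%g) (of_points (cube (act_nz rho) a gs)).

Lemma pair_act_of_points g h c :
  wmap (pair_act (g * h)%g) (of_points (wmap (act_nz rho g) c)) =
  wmap (pair_act h) (of_points c).
Proof.
have -> : of_points (wmap (act_nz rho g) c) = wmap (inl \o act_nz rho g) c.
  exact: wmap_comp.
rewrite !(wmap_comp (h := pair_act h \o inl)) // => a /=.
by rewrite act_nzM invgM mulgKV.
Qed.

(** The translation turns [g F(l) - F(l)] into the twisted [F(l) - g F(l)]: the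
    first term loses its [g], the second is missing one. *)
Lemma bd_twisted_cube a g gs :
  bd (twisted_cube a (g :: gs)) = - koszul pair_act (twisted_cube a) (g :: gs).
Proof.
rewrite /twisted_cube !bd_wmap bd_cube_cons; last first.
  by move=> h k x; rewrite !act_nzM Gab.
rewrite /koszul (raddf_alt of_points) (raddf_alt (wmap _)) (raddf_alt -%R).
apply: eq_alt => h l hl; rewrite /= (prod_deletion hl).
rewrite !(raddfB (wmap _)) /= opprB pair_act_of_points; congr (_ - _).
rewrite (wmap_comp (h := pair_act (h * \prod_(k <- l) k)%g)) // => x.
exact: pair_actM.
Qed.

Definition comparison a b (gs : seq G) : {freeg (seq letter) / int} :=
  cube pair_act (inr b) gs - (-1) ^+ size gs *: twisted_cube a gs.

Lemma bd_comparison a b gs :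
  bd (comparison a b gs) = koszul pair_act (comparison a b) gs.
Proof.
case: gs => [|g gs].
  rewrite /comparison raddfB raddfZsign /= scale1r bd_cube_nil /twisted_cube.
  by rewrite !bd_wmap bd_cube_nil !wmap_gen subrr.
rewrite koszulB raddfB raddfZsign; congr (_ - _).
  by rewrite -bd_cube_cons //; apply: pair_actC.
transitivity (koszul pair_act
  (fun l => (-1) ^+ size gs *: twisted_cube a l) (g :: gs)).
  rewrite koszulZsign [X in _ *: X]bd_twisted_cube scalerN exprS mulN1r scaleNr.
  exact: opprK.
by apply: eq_koszul => l [->].
Qed.

Lemma compatible_of_points m c :
  carried (fun w => size w = m) c -> carried (@compatible L V m) (of_points c).
Proof.
apply: carried_map => w wm; rewrite /= wmap_gen; apply: carried_gen.
split; first by rewrite size_map.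
by elim: w {wm} => //= a w ->; rewrite andbT; apply/allP => _ /mapP[a' _ ->].
Qed.

Lemma compatible_of_forms m c :
  carried (fun w => size w = m) c -> carried (@compatible L V m) (of_forms c).
Proof.
apply: carried_map => w wm; rewrite /= wmap_gen; apply: carried_gen.
split; first by rewrite size_map.
by elim: w {wm} => //= b w ->; rewrite andbT; apply/allP => _ /mapP[b' _ ->].
Qed.

Lemma cube_of_forms b gs :
  cube pair_act (inr b) gs = of_forms (cube (act_nz rho') b gs).
Proof. by rewrite (wmap_cube (act' := pair_act)). Qed.

Lemma comparison_carried a b gs :
  carried (@compatible L V (size gs).+1) (comparison a b gs).
Proof.
apply: zspanB; first by rewrite cube_of_forms; apply/compatible_of_forms/cube_size.
apply: zspanZ; apply: pair_act_carried; apply: compatible_of_points.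
exact: cube_size.
Qed.

(** By [form_chain_cycle] it vanishes in St(V^* ) on the cycles of X_n. *)
Definition defect (x : {freeg (seq letter) / int}) : chain n (dual_space V) :=
  form_chain n x - (-1) ^+ n *: duality (point_chain n x).

Lemma defect_is_additive : additive defect.
Proof.
move=> x y; rewrite /defect (raddfB (@form_chain L V n)).
rewrite (raddfB (@point_chain L V n)) (raddfB (@duality L V n)) /= scalerBr !opprB.
by rewrite addrACA [X in _ + _ + X]addrC addrACA.
Qed.

HB.instance Definition _ := GRing.isZmodMorphism.Build
  {freeg (seq letter) / int} (chain n (dual_space V)) defect defect_is_additive.

Lemma defect_act g x : defect (wmap (pair_act g) x) = act_chain rho' g (defect x).
Proof.
rewrite /defect form_chain_act point_chain_act duality_act.
pose f := @act_chain G L _ rho' n g.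
by rewrite [RHS](raddfB f) (raddfZsign f).
Qed.

Definition negligible : chain n (dual_space V) -> Prop :=
  zspan (fun y => coinv_ker rho' y \/ null_class y).

Lemma negligible_act g y : negligible (act_chain rho' g y - y).
Proof. by apply: zspan_gen; left; apply: zspan_gen; exists g, y. Qed.

Lemma defect_cycle x :
  carried (@compatible L V n) x -> bd x = 0 -> negligible (defect x).
Proof. by move=> xC xZ; apply: zspan_gen; right; apply: form_chain_cycle. Qed.

Lemma defect_koszul h gs : negligible (defect (koszul pair_act h gs)).
Proof.
rewrite /koszul (raddf_alt defect).
apply: (alt_closed (P := negligible)) => [||g l _].
- exact: zspan0.
- exact: zspanB.
- by rewrite raddfB /= defect_act; apply: negligible_act.
Qed.

(** A cycle of chains of V is a cycle of X without form part. *)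
Lemma duality_cycle (z : chain n V) : boundary z = 0 -> null_class (duality z).
Proof.
move=> zZ; have := form_chain_cycle dimV n_gt0 (x := of_points (of_chain z)) _ _.
rewrite form_chain_of_points /point_chain proj_lpart_inl of_chainK sub0r.
move=> H; rewrite -[duality z](signrZK n) -[X in _ *: X]opprK.
rewrite scalerN; apply/zspanN/zspanZ/H.
  exact/compatible_of_points/of_chain_size.
by rewrite bd_wmap bd_of_chain zZ !raddf0.
Qed.

Lemma duality_cube a b gs : size gs = n.-1 ->
  negligible (to_chain n (cube (act_nz rho') b gs) -
              duality (to_chain n (cube (act_nz rho) a gs))).
Proof.
move=> gsn.
have [h hP] : exists h, forall l, (size l < n)%N ->
    carried (@compatible L V (size l).+1)
      (comparison a b l - koszul pair_act h l) /\
    bd (comparison a b l - koszul pair_act h l) = 0.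
  apply: (koszul_homotopy pair_actC (K := fill b n)).
  - exact: pair_act_carried.
  - move=> m x mn xC xZ; apply: fillP xZ.
    apply: carriedW xC => w [wm ww].
    have wP : (size (points w) < n)%N.
      by rewrite size_pmap (leq_ltn_trans (count_size _ _)) ?wm.
    by split=> //; apply: nonspanning_size; rewrite dimV.
  - exact: comparison_carried.
  - exact: bd_comparison.
have sz : (size gs).+1 = n by rewrite gsn prednK.
have [] := hP gs; first by rewrite -sz.
rewrite sz => zC zZ.
have := zspanD (defect_cycle zC zZ) (defect_koszul h gs).
rewrite -raddfD /= subrK /comparison raddfB raddfZsign /= defect_act.
set P := (\prod_(h0 <- gs) h0)%g.
rewrite /defect cube_of_forms point_chain_of_forms form_chain_of_points.
rewrite /point_chain /form_chain.
rewrite proj_lpart_inl proj_rpart_inr raddf0 scaler0 subr0 sub0r.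
set F' := to_chain n _; set F := duality _;
have -> : (-1) ^+ n = - (-1) ^+ size gs :> int by rewrite -sz exprS mulN1r.
rewrite scaleNr opprK.
rewrite (raddfZsign (@act_chain G L _ rho' n P)) signrZK => cmp.
rewrite -[F' - F](subrKA (act_chain rho' P F)).
exact/zspanD/negligible_act.
Qed.

Lemma duality_coinv (x : chain n V) :
  coinv_ker rho x -> coinv_ker rho' (duality x).
Proof.
apply: zspan_map => _ [g [y ->]]; apply: zspan_gen.
exists g^-1%g, (duality y).
by rewrite raddfB -{1}[g]invgK; congr (_ - _); apply: duality_act.
Qed.

Lemma duality_degenerate (x : chain n V) : degenerate x -> duality x = 0.
Proof.
elim=> [_ [a fa ->]||y z _ y0 _ z0]; first exact: duality_dependent.
  exact: raddf0.
by rewrite raddfB /= y0 z0 subrr.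
Qed.

Lemma null_classP m (U : vectType L) (y : chain m U) : null_class y ->
  exists d c : chain m U, [/\ degenerate d, boundary c = 0 & y = d + c].
Proof.
elim=> [z [zd|zc]||_ _ _ [d [c [dd cc ->]]] _ [d' [c' [dd' cc' ->]]]].
- by exists z, 0; rewrite raddf0 addr0.
- by exists 0, z; rewrite add0r; split=> //; apply: zspan0.
- by exists 0, 0; rewrite raddf0 addr0; split=> //; apply: zspan0.
exists (d - d'), (c - c'); split; first exact: zspanB.
  by rewrite raddfB /= cc cc' subrr.
by rewrite opprD addrACA.
Qed.

Lemma negligibleP y : negligible y -> exists x d c : chain n (dual_space V),
  [/\ coinv_ker rho' x, degenerate d, boundary c = 0 & y = x + d + c].
Proof.
elim=> [z [zi|/null_classP[d [c [dd cc ->]]]]||].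
- by exists z, 0, 0; rewrite raddf0 !addr0; split=> //; apply: zspan0.
- by exists 0, d, c; rewrite add0r; split=> //; apply: zspan0.
- by exists 0, 0, 0; rewrite raddf0 !addr0; split=> //; apply: zspan0.
move=> _ _ _ [x [d [c [xx dd cc ->]]]] _ [x' [d' [c' [xx' dd' cc' ->]]]].
exists (x - x'), (d - d'), (c - c'); split; [exact: zspanB | exact: zspanB | |].
  by rewrite raddfB /= cc cc' subrr.
by rewrite !opprD addrACA (addrACA x).
Qed.

End Duality.

Theorem theorem3p22 (L : fieldType) (V : vectType L) (n : nat)
    (dimV : \dim {:V} = n) (G : groupType) (Gab : forall h k : G, commute h k)
    (rho : linear_action G V) (g : 'I_n.-1 -> G) (D : chain n V) :
  fundamental_domain_fan rho g D ->
  fundamental_domain_fan (dual_action Gab rho) g (duality D).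
Proof.
case=> a [x [y [z [xI yW zZ DE]]]].
have n_gt0 : (0 < n)%N.
  rewrite -dimV lt0n; apply: contraNneq (valP a) => /eqP; rewrite dimv_eq0 => V0.
  by rewrite -memv0 -(eqP V0) memvf.
(* Any nonzero form may serve as base point of the dual fan. *)
have [|b _] := exists_killing (A := [::] : seq (nzvec V)).
  by apply: nonspanning_size; rewrite dimV.
exists b; apply: negligibleP.
case: n n_gt0 dimV g D x y z xI yW zZ DE => // k n_gt0 dimV g D x y z xI yW zZ DE.
have -> : D = fan rho g a + (x + y + z) by rewrite -DE addrC subrK.
have cmp : negligible Gab rho
    (fan (dual_action Gab rho) g b - duality (fan rho g a)).
  rewrite -!to_chain_cube; apply: duality_cube => //.
  by rewrite size_map size_enum_ord.
rewrite !raddfD /= (duality_degenerate yW) addr0.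
rewrite addrAC -opprB; apply: zspanD; first exact: zspanN.
apply: zspanD; apply: zspan_gen; [left; exact: duality_coinv | right].
exact: duality_cycle.
Qed.
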